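(* Let $(M^{2n},\theta,\mu)$ be a $(2n,k)$-manifold with $\mu(M^{2n})=P^k$. Let $x\in P^k$ be a regular point, i.e. $\dim P_\sigma=k$ for every admissible polytope $P_\sigma$ with $x\in\mathring{P_\sigma}$. Then $x$ is a regular value of the almost moment map $\mu:M^{2n}\to P^k$, i.e. the differential of $\mu$ has rank $k$ at every point of $\mu^{-1}(x)$.
   Context: Conventions. $T^k=(S^1)^k$; $\mathring{P}$ is the relative interior of a convex polytope $P$ (a point is its own relative interior); for a subset $Y$ of a topological space, $\bar\partial Y=\overline{Y}\setminus Y$; $[1,m]=\{1,\dots,m\}$. A $(2n,k)$-manifold ($1\le k\le n$) is a triple $(M^{2n},\theta,\mu)$: $M^{2n}$ is a smooth closed oriented $2n$-manifold; $\theta$ is a smooth effective action of $T^k$ on $M^{2n}$ all of whose stabilizers are connected; $\mu:M^{2n}\to\mathbb{R}^k$ (the almost moment map) is a smooth $T^k$-invariant map whose image is a $k$-dimensional convex polytope $P^k$ and which is open as a map onto $P^k$; and Axioms 1-6 hold. Axiom 1. There is a smooth atlas $\{(M_i,\varphi_i)\}$ of $M^{2n}$ with $M_i$ open, $T^k$-invariant and dense, $\varphi_i:M_i\to\mathbb{R}^{2n}$ coordinate homeomorphisms, each $M_i$ containing exactly one $T^k$-fixed point $x_i$, with $\varphi_i(x_i)=0$ and $x_i\ne x_j$ for $i\neq j$. (The atlas is finite, indexed by $[1,m]$, $m$ being the number of fixed points.) Put $Y_i=M^{2n}\setminus M_i$, and for $\sigma\subseteq[1,m]$ put $W_\sigma=\bigcap_{i\in\sigma}M_i\cap\bigcap_{i\notin\sigma}Y_i$.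 If $W_\sigma\ne\emptyset$, it is called a stratum and $\sigma$ is called admissible; $\mathfrak{S}$ is the set of admissible sets. The strata are $T^k$-invariant and partition $M^{2n}$. The main stratum is $W=W_{[1,m]}$. Axiom 2. $\mu$ gives a bijection between the fixed points and the vertices of $P^k$. Put $v_i=\mu(x_i)$; for $\sigma\in\mathfrak{S}$ the admissible polytope is $P_\sigma=\mathrm{conv}\{v_i:i\in\sigma\}$. Axiom 3. The stabilizer is constant on each stratum. Let $T^\sigma$ be the quotient of $T^k$ by the stabilizer of points of $W_\sigma$; it acts freely on $W_\sigma$ and $W_\sigma/T^\sigma=W_\sigma/T^k$. Axiom 4. Let $\widehat\mu:M^{2n}/T^k\to P^k$ be induced by $\mu$. For $\sigma\in\mathfrak{S}$: (a) $\mu(W_\sigma)=\mathring{P_\sigma}$; (b) the restriction $\widehat\mu_\sigma:W_\sigma/T^\sigma\to\mathring{P_\sigma}$ is a fiber bundle; (c) $\dim P_\sigma=\dim T^\sigma$. This bundle is trivial (contractible base); its fiber $F_\sigma$ is the space of parameters of $W_\sigma$, and $F$ is that of the main stratum. A trivialization $h_\sigma:W_\sigma/T^\sigma\to\mathring{P_\sigma}\times F_\sigma$ over $\mathring{P_\sigma}$ is fixed as part of the structure; $\xi_\sigma:W_\sigma/T^\sigma\to F_\sigma$ is its second component. For $c\in F_\sigma$ the leaf $W_\sigma[\xi_\sigma,c]\subset W_\sigma$ is the preimage of $\xi_\sigma^{-1}(c)$ under $W_\sigma\to W_\sigma/T^\sigma$. Axiom 5. For every leaf $W_\sigma[\xi_\sigma,c_\sigma]$: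 (a) it is a smooth submanifold of $M^{2n}$ and $\mu$ restricts to a smooth fiber bundle $W_\sigma[\xi_\sigma,c_\sigma]\to\mathring{P_\sigma}$; (b) $\bar\partial W_\sigma[\xi_\sigma,c_\sigma]$ is the union of leaves $W_{\bar\sigma}[\xi_{\bar\sigma},c_{\bar\sigma}]$, for exactly one $c_{\bar\sigma}\in F_{\bar\sigma}$ for each $\bar\sigma$, where $P_{\bar\sigma}$ runs through some admissible faces of $P_\sigma$; (c) the map $\eta_{\sigma,\bar\sigma}:F_\sigma\to F_{\bar\sigma}$, $c_\sigma\mapsto c_{\bar\sigma}$, given by (b) is continuous. Complexes. $C(M^{2n},P^k)=\bigsqcup_{\sigma\in\mathfrak{S}}P'_\sigma$ is a formal disjoint union of copies $P'_\sigma$ of $\mathring{P_\sigma}$; $\widehat\pi:C(M^{2n},P^k)\to P^k$ is the canonical map, identifying each $P'_\sigma$ with $\mathring{P_\sigma}$. The map $f:M^{2n}\to C(M^{2n},P^k)$ sends $y\in W_\sigma$ to the unique $x\in P'_\sigma$ with $\widehat\pi(x)=\mu(y)$. $CQ(M^{2n},P^k)$ is $C(M^{2n},P^k)$ with the quotient topology of $f$. The space $\mathfrak{E}(M^{2n},P^k)=\{(x,y)\in C(M^{2n},P^k)\times M^{2n}: x\in P'_\sigma,\ y\in W_\sigma\text{ for some }\sigma\in\mathfrak{S},\ \widehat\pi(x)=\mu(y)\}$ has the topology induced from $CQ(M^{2n},P^k)\times M^{2n}$; $T^k$ acts on it through the second factor. Points of $\mathfrak{E}(M^{2n},P^k)/T^k$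 are written as pairs $(x,c)$, $x\in P'_\sigma$, $c\in F_\sigma$, via $h_\sigma$. Axiom 6. There are a topological space $\mathcal{F}$ and, for each $\sigma\in\mathfrak{S}$, a topological space $\tilde F_\sigma$ and a continuous inclusion $I_\sigma:\tilde F_\sigma\to\mathcal{F}$ (write $\tilde F,I$ for $\sigma=[1,m]$ and $\tilde F_i,I_i$ for $\sigma=\{i\}$) such that: (a) $\tilde F=F$ and $\mathcal{F}$ is a compactification of $I(F)$; (b) $I_\sigma(\tilde F_\sigma)\subset I_{\bar\sigma}(\tilde F_{\bar\sigma})$ whenever $P_{\bar\sigma}$ is an admissible face of $P_\sigma$, and $\mathcal{F}=\bigcup_{i=1}^m I_i(\tilde F_i)$; (c) there are continuous projections $p_\sigma:\tilde F_\sigma\to F_\sigma$ with $p_{\bar\sigma}\circ\tilde\eta_{\sigma,\bar\sigma}=\eta_{\sigma,\bar\sigma}\circ p_\sigma$, where $\tilde\eta_{\sigma,\bar\sigma}:\tilde F_\sigma\to\tilde F_{\bar\sigma}$ is the inclusion given by (b); (d) the map $H:\mathcal{E}=\bigcup_\sigma P'_\sigma\times\tilde F_\sigma\to\mathfrak{E}(M^{2n},P^k)/T^k$, $H(x,\tilde c)=(x,p_\sigma(\tilde c))$, is continuous, where $\mathcal{E}$ has the topology induced by the embedding $\mathcal{E}\to CQ(M^{2n},P^k)\times\mathcal{F}$, $(x,\tilde c)\mapsto(x,I_\sigma(\tilde c))$. *)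

(* Defs.v *)
From HB Require Import structures.
From mathcomp Require Import all_boot all_order all_algebra.
From mathcomp Require Import all_classical all_reals all_analysis.
From mathcomp Require Import generic_quotient ring.

Set Implicit Arguments.
Unset Strict Implicit.
Unset Printing Implicit Defensive.

Import Order.TTheory GRing.Theory Num.Theory.
Import numFieldNormedType.Exports.

Local Open Scope classical_set_scope.
Local Open Scope ring_scope.

(* Subspaces are sets in an ambient space, carrying the subspace topology;
   maps between them are total functions, constrained only on the subspace. *)
Definition homeo_on (X Y : topologicalType) (A : set X) (B : set Y)
    (f : X -> Y) : Prop :=
  exists g : Y -> X,
    [/\ {within A, continuous f}, {within B, continuous g},
        (forall x, A x -> B (f x) /\ g (f x) = x) &
        (forall y, B y -> A (g y) /\ f (g y) = y)].

Definition bdiff (X : topologicalType) (A : set X) : set X := closure A `\` A.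

(* [final_topology f] is the codomain of [f] with the finest topology making
   [f] continuous: its trace on [range f] is the quotient topology of [f]. *)
Section FinalTopology.
Variables (S : topologicalType) (T : choiceType) (f : S -> T).

Definition final_topology : Type := let _ := f in T.
HB.instance Definition _ := Choice.copy final_topology T.

Definition final_open (U : set final_topology) : Prop := open (f @^-1` U).

Lemma final_openT : final_open setT.
Proof. by rewrite /final_open preimage_setT; exact: openT. Qed.

Lemma final_openI (A B : set final_topology) :
  final_open A -> final_open B -> final_open (A `&` B).
Proof. by rewrite /final_open preimage_setI; exact: openI. Qed.

Lemma final_open_bigcup (I : Type) (g : I -> set final_topology) :
  (forall i, final_open (g i)) -> final_open (\bigcup_i g i).
Proof.
by move=> og; rewrite /final_open preimage_bigcup; apply: bigcup_open => i _;
  exact: og.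
Qed.

HB.instance Definition _ := @isOpenTopological.Build final_topology
  final_open final_openT final_openI final_open_bigcup.
End FinalTopology.

Section Smooth.
Variable R : realType.

(* [C^r] maps on an open set of R^a, through iterated directional
   derivatives. *)
Fixpoint Cdiff (r a b : nat) (U : set 'rV[R]_a) (f : 'rV[R]_a -> 'rV[R]_b)
    : Prop :=
  if r is r'.+1 then
    (forall x, U x -> differentiable f x) /\
    (forall v, Cdiff r' U (fun x => 'D_v f x))
  else {within U, continuous f}.

Definition smooth (a b : nat) (U : set 'rV[R]_a) (f : 'rV[R]_a -> 'rV[R]_b)
    : Prop :=
  forall r, Cdiff r U f.

Record chart (d : nat) (X : Type) := Chart {
  cdom : set X;
  cmap : X -> 'rV[R]_d;
  cinv : 'rV[R]_d -> X }.

Definition cimg d X (c : chart d X) : set 'rV[R]_d := cmap c @` cdom c.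

Definition is_chart d (X : topologicalType) (c : chart d X) : Prop :=
  [/\ open (cdom c), open (cimg c),
      {within cdom c, continuous (cmap c)},
      {within cimg c, continuous (cinv c)} &
      forall x, cdom c x -> cinv c (cmap c x) = x].

Definition smooth_transition d (X : topologicalType) (c c' : chart d X)
    : Prop :=
  smooth (cmap c @` (cdom c `&` cdom c')) (cmap c' \o cinv c).

(* Atlases need not be maximal; [smooth_chart A] is the maximal atlas. *)
Definition smooth_manifold d (X : topologicalType) (A : set (chart d X))
    : Prop :=
  [/\ hausdorff_space X, @second_countable X,
      (forall c, A c -> is_chart c),
      (forall x, exists2 c, A c & cdom c x) &
      (forall c c', A c -> A c' -> smooth_transition c c')].

Definition smooth_chart d (X : topologicalType) (A : set (chart d X))
    (c : chart d X) : Prop :=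
  is_chart c /\
  forall c', A c' -> smooth_transition c c' /\ smooth_transition c' c.

Definition oriented d (X : topologicalType) (A : set (chart d X)) : Prop :=
  forall c c', A c -> A c' -> forall x, cdom c x -> cdom c' x ->
    0 < \det ('J (cmap c' \o cinv c) (cmap c x)).

Definition euclid d : set (chart d 'rV[R]_d) := [set Chart setT id id].

Definition prod_chart a b X Y (c : chart a X) (c' : chart b Y)
    : chart (a + b) (X * Y) :=
  Chart (cdom c `*` cdom c')
    (fun p => row_mx (cmap c p.1) (cmap c' p.2))
    (fun v => (cinv c (lsubmx v), cinv c' (rsubmx v))).

Definition prod_atlas a b X Y (A : set (chart a X)) (B : set (chart b Y))
    : set (chart (a + b) (X * Y)) :=
  [set prod_chart p.1 p.2 | p in A `*` B].

(* To be used with [U] open. *)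
Definition smooth_on a b (X Y : topologicalType)
    (A : set (chart a X)) (B : set (chart b Y)) (U : set X) (f : X -> Y)
    : Prop :=
  {within U, continuous f} /\
  forall c c', A c -> B c' ->
    smooth (cmap c @` (cdom c `&` U `&` f @^-1` cdom c'))
           (cmap c' \o f \o cinv c).

(* Smoothness on an arbitrary subset: local existence of smooth extensions.
   On (and into) embedded submanifolds this is intrinsic smoothness. *)
Definition smooth_within a b (X Y : topologicalType)
    (A : set (chart a X)) (B : set (chart b Y)) (S : set X) (f : X -> Y)
    : Prop :=
  forall x, S x -> exists (U : set X) (g : X -> Y),
    [/\ open U, U x, smooth_on A B U g & forall y, S y -> U y -> g y = f y].

Definition diffeo_on a b (X Y : topologicalType)
    (A : set (chart a X)) (B : set (chart b Y)) (S : set X) (T : set Y)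
    (f : X -> Y) : Prop :=
  exists g : Y -> X,
    [/\ smooth_within A B S f, smooth_within B A T g,
        (forall x, S x -> T (f x) /\ g (f x) = x) &
        (forall y, T y -> S (g y) /\ f (g y) = y)].

Definition submanifold d (X : topologicalType) (A : set (chart d X))
    (e : nat) (S : set X) : Prop :=
  (e <= d)%N /\
  forall x, S x -> exists c : chart d X,
    [/\ smooth_chart A c, cdom c x &
        cmap c @` (S `&` cdom c) =
        cimg c `&` [set v | forall j : 'I_d, (e <= j)%N -> v 0 j = 0]].

(* [p] restricts to a smooth fiber bundle from the submanifold [S] onto the
   submanifold [D] of R^k, with fiber some smooth manifold [N]. *)
Definition smooth_bundle d k (X : topologicalType) (A : set (chart d X))
    (S : set X) (D : set 'rV[R]_k) (p : X -> 'rV[R]_k) : Prop :=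
  p @` S `<=` D /\
  exists (N : topologicalType) (e : nat) (B : set (chart e N)),
    smooth_manifold B /\
    forall b, D b -> exists (O : set 'rV[R]_k) (phi : X -> N),
      [/\ open O, O b &
          diffeo_on A (prod_atlas (@euclid k) B)
            (S `&` p @^-1` O) ((D `&` O) `*` setT)
            (fun x => (p x, phi x))].

Definition rank_at d k (X : topologicalType) (A : set (chart d X))
    (f : X -> 'rV[R]_k) (x : X) (r : nat) : Prop :=
  forall c, A c -> cdom c x -> \rank ('J (f \o cinv c) (cmap c x)) = r.

End Smooth.

Section Polytopes.
Variables (R : realType) (k : nat).
Implicit Types (P Q A : set 'rV[R]_k).

Definition conv (I : finType) (v : I -> 'rV[R]_k) (s : {set I})
    : set 'rV[R]_k :=
  [set x | exists a : I -> R,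
     [/\ forall i, i \in s -> 0 <= a i, \sum_(i in s) a i = 1 &
         x = \sum_(i in s) a i *: v i]].

Definition affine_hull A : set 'rV[R]_k :=
  [set x | exists (r : nat) (v : 'I_r -> 'rV[R]_k) (a : 'I_r -> R),
     [/\ forall i, A (v i), \sum_i a i = 1 & x = \sum_i a i *: v i]].

Definition relint A : set 'rV[R]_k :=
  [set x | A x /\ exists2 O : set 'rV[R]_k,
     open O /\ O x & O `&` affine_hull A `<=` A].

(* Dimension of the linear span. *)
Definition lin_dim A : nat :=
  \max_(r < k.+1 | `[< exists B : 'M[R]_(r, k),
                        row_free B /\ forall i, A (row i B) >]) r.

Definition affine_dim A : nat := lin_dim [set p.1 - p.2 | p in A `*` A].

Definition polytope P : Prop :=
  exists (r : nat) (v : 'I_r -> 'rV[R]_k), P = conv v finset.setT.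

Definition face Q P : Prop :=
  Q !=set0 /\
  exists l : 'cV[R]_k,
    Q = [set x | P x /\ forall y, P y -> (y *m l) 0 0 <= (x *m l) 0 0].

Definition vertex P (v : 'rV[R]_k) : Prop := face [set v] P.

End Polytopes.

Section Torus.
Variables (R : realType) (k : nat).

(* C^k, as pairs (real parts, imaginary parts), with componentwise
   multiplication. *)
Local Notation Ck := ('rV[R]_k * 'rV[R]_k)%type.

Definition torus : set Ck :=
  [set z : Ck | forall i, z.1 0 i ^+ 2 + z.2 0 i ^+ 2 = 1].

Definition tone : Ck := (const_mx 1, 0).

Definition tmul (z w : Ck) : Ck :=
  (\row_i (z.1 0 i * w.1 0 i - z.2 0 i * w.2 0 i),
   \row_i (z.1 0 i * w.2 0 i + z.2 0 i * w.1 0 i)).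

Definition tinv (z : Ck) : Ck := (z.1, - z.2).

Definition texp (s : 'rV[R]_k) : Ck := (map_mx cos s, map_mx sin s).

Lemma torus1 : torus tone.
Proof. by move=> i; rewrite !mxE expr1n expr0n addr0. Qed.

Lemma torusM z w : torus z -> torus w -> torus (tmul z w).
Proof.
move=> tz tw i; rewrite !mxE -[RHS](mulr1 1) -{1}(tz i) -(tw i).
by ring.
Qed.

Lemma torusV z : torus z -> torus (tinv z).
Proof. by move=> tz i; rewrite !mxE sqrrN. Qed.

Lemma tmulVz z : torus z -> tmul (tinv z) z = tone.
Proof.
move=> tz; congr pair; apply/rowP => i; rewrite !mxE.
  by rewrite mulNr opprK -!expr2.
by rewrite mulNr mulrC subrr.
Qed.

(* Only the values on [torus] are meaningful. *)
Record torus_action (X : Type) := TorusAction {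
  act :> Ck -> X -> X;
  act1 : forall x, act tone x = x;
  actM : forall g h x, torus g -> torus h ->
    act (tmul g h) x = act g (act h x) }.

Definition orbit_rel (X : Type) (th : torus_action X) : rel X :=
  fun x y => `[< exists2 g, torus g & th g x = y >].

Section OrbitSpace.
Variables (X : topologicalType) (th : torus_action X).

Lemma orbit_rel_refl : reflexive (orbit_rel th).
Proof. by move=> x; apply/asboolP; exists tone; [exact: torus1|exact: act1]. Qed.

Lemma orbit_rel_imp x y : orbit_rel th x y -> orbit_rel th y x.
Proof.
move=> /asboolP[g tg <-]; apply/asboolP; exists (tinv g); first exact: torusV.
by rewrite -actM ?tmulVz ?act1 //; exact: torusV.
Qed.

Lemma orbit_rel_sym : symmetric (orbit_rel th).
Proof. by move=> x y; apply/idP/idP; exact: orbit_rel_imp. Qed.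

Lemma orbit_rel_trans : transitive (orbit_rel th).
Proof.
move=> y x z /asboolP[g tg <-] /asboolP[h t_h <-]; apply/asboolP.
by exists (tmul h g); [exact: torusM|exact: actM].
Qed.

Definition orbit_equiv : equiv_rel X :=
  EquivRel (orbit_rel th) orbit_rel_refl orbit_rel_sym orbit_rel_trans.

Definition orbit_space : topologicalType :=
  quotient_topology {eq_quot orbit_equiv}%qT.

(* As orbit projections are open, for an invariant [A] the subspace topology
   on [orb @` A] is the quotient topology of [A] by the torus. *)
Definition orb (x : X) : orbit_space := \pi_{eq_quot orbit_equiv}%qT x.

Definition stab (x : X) : set Ck := [set g | torus g /\ th g x = x].

Definition fixed_point (x : X) : Prop := forall g, torus g -> th g x = x.

Definition invariant_set (A : set X) : Prop :=
  forall g x, torus g -> A x -> A (th g x).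

Definition effective : Prop :=
  forall g, torus g -> (forall x, th g x = x) -> g = tone.

(* Smoothness of T^k x X -> X, read through the surjective local
   diffeomorphism [texp : R^k -> T^k]. *)
Definition smooth_action d (A : set (chart R d X)) : Prop :=
  smooth_on (prod_atlas (@euclid R k) A) A setT
    (fun p : 'rV[R]_k * X => th (texp p.1) p.2).

End OrbitSpace.

Definition lie_algebra (H : set Ck) : set 'rV[R]_k :=
  [set v | forall t : R, H (texp (t *: v))].

(* dim (T^k / H) for a closed subgroup [H]. *)
Definition quotient_dim (H : set Ck) : nat := (k - lin_dim (lie_algebra H))%N.

Section SecondFactor.
Variables (X Y : Type) (th : torus_action Y).

Definition snd_act (g : Ck) (p : X * Y) : X * Y := (p.1, th g p.2).

Lemma snd_act1 p : snd_act tone p = p.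
Proof. by case: p => x y; rewrite /snd_act act1. Qed.

Lemma snd_actM g h p : torus g -> torus h ->
  snd_act (tmul g h) p = snd_act g (snd_act h p).
Proof. by move=> tg t_h; rewrite /snd_act actM. Qed.

Definition snd_action : torus_action (X * Y) :=
  TorusAction snd_act1 snd_actM.
End SecondFactor.

End Torus.

Section Strata.
Variables (R : realType) (d k m : nat) (M : topologicalType).
Variables (theta : torus_action R k M) (mu : M -> 'rV[R]_k).
Variables (ch : 'I_m -> chart R d M) (fp : 'I_m -> M).
Implicit Types (s t : {set 'I_m}).

Definition stratum s : set M :=
  (\bigcap_(i in [set i | i \in s]) cdom (ch i)) `&`
  (\bigcap_(i in [set i | i \notin s]) ~` cdom (ch i)).

Definition admissible s : Prop := stratum s !=set0.

Definition adm_polytope s : set 'rV[R]_k := conv (mu \o fp) s.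

Definition adm_face t s : Prop :=
  [/\ admissible s, admissible t & face (adm_polytope t) (adm_polytope s)].

Definition stratum_index (y : M) : {set 'I_m} :=
  finset (fun i => `[< cdom (ch i) y >]).

(* The disjoint union of copies of the open admissible polytopes is the set
   [complex] below; it is the range of [to_complex]. *)
Definition to_complex (y : M) : {set 'I_m} * 'rV[R]_k :=
  (stratum_index y, mu y).

Definition CQ : topologicalType := final_topology to_complex.

Definition complex : set CQ :=
  [set q : CQ | admissible q.1 /\ relint (adm_polytope q.1) q.2].

Definition frakE : set (CQ * M) :=
  [set p | [/\ complex p.1, stratum p.1.1 p.2 & p.1.2 = mu p.2]].

Definition frakE_orb : CQ * M -> orbit_space (snd_action CQ theta) :=
  @orb R k (CQ * M)%type (snd_action CQ theta).

Section Leaves.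
Variable F : {set 'I_m} -> topologicalType.
Variable h : forall s, orbit_space theta -> 'rV[R]_k * F s.

Definition xi s (q : orbit_space theta) : F s := (h s q).2.

Definition leaf s (c : F s) : set M :=
  [set y | stratum s y /\ xi s (orb theta y) = c].

Section Extended.
Variables (Fc : topologicalType) (Ft : {set 'I_m} -> topologicalType).
Variable I : forall s, Ft s -> Fc.
Variable p : forall s, Ft s -> F s.

Definition calE : set (CQ * Fc) :=
  [set q | complex q.1 /\ range (@I q.1.1) q.2].

(* [H (x, c~) = (x, p c~)], where the pair [(x, c)] denotes the orbit of
   [(x, y)] for any [y] in the stratum with [mu y = x] and [xi [y] = c]. *)
Definition is_H (H : CQ * Fc -> orbit_space (snd_action CQ theta)) : Prop :=
  forall s (x : 'rV[R]_k) (c : Ft s) (y : M),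
    frakE (((s, x) : CQ), y) -> xi s (orb theta y) = p c ->
    H (((s, x) : CQ), I c) = frakE_orb (((s, x) : CQ), y).
End Extended.
End Leaves.
End Strata.

Section Conditions.
Variables (R : realType) (d k m : nat) (M : topologicalType).
Variables (atlas : set (chart R d M)).
Variables (theta : torus_action R k M) (mu : M -> 'rV[R]_k).
Variables (ch : 'I_m -> chart R d M) (fp : 'I_m -> M).
Implicit Types (s t : {set 'I_m}).

Definition axiom1 : Prop :=
  [/\ (forall i, [/\ smooth_chart atlas (ch i), cimg (ch i) = setT,
                     invariant_set theta (cdom (ch i)) &
                     dense (cdom (ch i))]),
      \bigcup_i cdom (ch i) = setT,
      (forall i, [set y | fixed_point theta y /\ cdom (ch i) y] = [set fp i]),
      (forall i, cmap (ch i) (fp i) = 0) &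
      injective fp].

Definition axiom2 : Prop :=
  set_bij [set y | fixed_point theta y] [set v | vertex (range mu) v] mu.

Definition axiom3 : Prop :=
  forall s y z, stratum ch s y -> stratum ch s z ->
    stab theta y = stab theta z.

Variables (F : {set 'I_m} -> topologicalType).
Variable h : forall s, orbit_space theta -> 'rV[R]_k * F s.

(* The homeomorphism [h s] over the open polytope is the fixed trivialization
   of the bundle [orb theta @` stratum ch s -> D]. *)
Definition axiom4 : Prop :=
  forall s, admissible ch s ->
    let D := relint (adm_polytope mu fp s) in
    [/\ mu @` stratum ch s = D,
        homeo_on (orb theta @` stratum ch s) (D `*` setT) (h s),
        (forall y, stratum ch s y -> (h s (orb theta y)).1 = mu y) &
        (forall y, stratum ch s y ->
           affine_dim (adm_polytope mu fp s) = quotient_dim (stab theta y))].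

(* [bf s] is the set of indices of the admissible faces of P_s over which the
   boundaries of the leaves of the stratum of [s] lie. *)
Variables (bf : {set 'I_m} -> {set {set 'I_m}}).
Variable eta : forall s t, F s -> F t.

Definition axiom5 : Prop :=
  forall s, admissible ch s ->
    [/\ (forall c : F s,
           (exists e, submanifold atlas e (leaf ch h c)) /\
           smooth_bundle atlas (leaf ch h c)
             (relint (adm_polytope mu fp s)) mu),
        (forall t, t \in bf s -> adm_face mu ch fp t s),
        (forall c : F s, bdiff (leaf ch h c) =
           \bigcup_(t in [set t | t \in bf s]) leaf ch h (@eta s t c)),
        (forall (c : F s) t, t \in bf s -> forall c' : F t,
           leaf ch h c' `<=` bdiff (leaf ch h c) -> c' = @eta s t c) &
        (forall t, t \in bf s -> continuous (@eta s t))].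

Variables (Fc : topologicalType) (Ft : {set 'I_m} -> topologicalType).
Variable I : forall s, Ft s -> Fc.
Variable p : forall s, Ft s -> F s.

Definition axiom6_inclusions : Prop :=
  forall s, admissible ch s -> continuous (@I s) /\ injective (@I s).

Definition axiom6a : Prop :=
  [/\ (exists j, homeo_on [set: Ft finset.setT] [set: F finset.setT] j),
      compact [set: Fc] & dense (range (@I finset.setT))].

Definition axiom6b : Prop :=
  (forall s t, adm_face mu ch fp t s -> range (@I s) `<=` range (@I t)) /\
  \bigcup_(i : 'I_m) range (@I (finset.set1 i)) = [set: Fc].

(* [I c' = I c] says that [c'] is the image of [c] under the inclusion of
   [Ft s] into [Ft t]. *)
Definition axiom6c : Prop :=
  (forall s, admissible ch s ->
     continuous (@p s) /\ range (@p s) = setT) /\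
  (forall s t, admissible ch s -> t \in bf s ->
     forall (c : Ft s) (c' : Ft t), I c' = I c -> p c' = @eta s t (p c)).

Definition axiom6d : Prop :=
  exists2 H : CQ mu ch * Fc -> orbit_space (snd_action (CQ mu ch) theta),
    is_H fp h I p H & {within calE fp I, continuous H}.

End Conditions.

Record nk_manifold (R : realType) (n k : nat) := NkManifold {
  nk_M : topologicalType;
  nk_atlas : set (chart R n.*2 nk_M);
  nk_theta : torus_action R k nk_M;
  nk_mu : nk_M -> 'rV[R]_k;
  nk_range : (1 <= k <= n)%N;
  nk_smooth : smooth_manifold nk_atlas;
  nk_compact : compact [set: nk_M];
  nk_oriented : oriented nk_atlas;
  nk_theta_smooth : smooth_action nk_theta nk_atlas;
  nk_theta_effective : effective nk_theta;
  nk_theta_stab : forall y, connected (stab nk_theta y);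
  nk_mu_smooth : smooth_on nk_atlas (@euclid R k) setT nk_mu;
  nk_mu_invariant : forall g y, torus g -> nk_mu (nk_theta g y) = nk_mu y;
  nk_mu_polytope : polytope (range nk_mu);
  nk_mu_dim : affine_dim (range nk_mu) = k;
  nk_mu_open : forall U, open U ->
    exists2 O : set 'rV[R]_k, open O & nk_mu @` U = O `&` range nk_mu;
  nk_m : nat;
  nk_ch : 'I_nk_m -> chart R n.*2 nk_M;
  nk_fp : 'I_nk_m -> nk_M;
  nk_axiom1 : axiom1 nk_atlas nk_theta nk_ch nk_fp;
  nk_axiom2 : axiom2 nk_theta nk_mu;
  nk_axiom3 : axiom3 nk_theta nk_ch;
  (* Values at non-admissible sets are irrelevant from here on. *)
  nk_F : {set 'I_nk_m} -> topologicalType;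
  nk_h : forall s, orbit_space nk_theta -> 'rV[R]_k * nk_F s;
  nk_axiom4 : axiom4 nk_mu nk_ch nk_fp nk_h;
  nk_bf : {set 'I_nk_m} -> {set {set 'I_nk_m}};
  nk_eta : forall s t, nk_F s -> nk_F t;
  nk_axiom5 : axiom5 nk_atlas nk_mu nk_ch nk_fp nk_h nk_bf nk_eta;
  nk_Fc : topologicalType;
  nk_Ft : {set 'I_nk_m} -> topologicalType;
  nk_I : forall s, nk_Ft s -> nk_Fc;
  nk_p : forall s, nk_Ft s -> nk_F s;
  nk_axiom6i : axiom6_inclusions nk_ch nk_I;
  nk_axiom6a : axiom6a nk_F nk_I;
  nk_axiom6b : axiom6b nk_mu nk_ch nk_fp nk_I;
  nk_axiom6c : axiom6c nk_ch nk_bf nk_eta nk_I nk_p;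
  nk_axiom6d : axiom6d nk_mu nk_ch nk_fp nk_h nk_I nk_p }.

Definition nk_polytope (R : realType) (n k : nat) (X : nk_manifold R n k)
    : set 'rV[R]_k :=
  range (@nk_mu R n k X).

Definition regular_point (R : realType) (n k : nat) (X : nk_manifold R n k)
    (x : 'rV[R]_k) : Prop :=
  forall s, admissible (@nk_ch R n k X) s ->
    relint (adm_polytope (@nk_mu R n k X) (@nk_fp R n k X) s) x ->
    affine_dim (adm_polytope (@nk_mu R n k X) (@nk_fp R n k X) s) = k.

Definition regular_value (R : realType) (n k : nat) (X : nk_manifold R n k)
    (x : 'rV[R]_k) : Prop :=
  forall y, @nk_mu R n k X y = x ->
    rank_at (@nk_atlas R n k X) (@nk_mu R n k X) y k.

(* Main.v *)
Require Import Defs.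
From mathcomp Require Import all_boot all_order all_algebra.
From mathcomp Require Import all_classical all_reals all_analysis.

Set Implicit Arguments.
Unset Strict Implicit.
Unset Printing Implicit Defensive.

Import GRing.Theory.
Import numFieldNormedType.Exports.

(** A submersion is detected by a differentiable local section: if
    [mu \o s = id] near [x] in R^k, then by the chain rule the differential of
    [mu] at [s x] has a right inverse, so it has rank [k]
    ([jacobian_rank_right_inverse], [smooth_section_rank]).

    Such sections come from the leaves. A point [y] over [x] lies on a leaf of
    its stratum, and [mu] makes that leaf a smooth bundle over the relative
    interior of the admissible polytope of the stratum; holding the fiber
    coordinate of [y] fixed in a local trivialization gives a smooth section
    of [mu] through [y], defined over a neighborhood of [x] within that
    relative interior ([smooth_bundle_rank]).

    Regularity of [x] is what makes this a full neighborhood of [x] in R^k: the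
    polytope has dimension [k], its affine hull is all of R^k
    ([affine_hull_full]), and its relative interior is its interior
    ([relint_full_nbhs]). Over a polytope of smaller dimension the same section
    would only bound the rank from below by that dimension. *)

Local Open Scope classical_set_scope.
Local Open Scope ring_scope.

Lemma lin_dim_full (R : realType) (k : nat) (A : set 'rV[R]_k) :
  lin_dim A = k ->
  exists2 B : 'M[R]_k, B \in unitmx & forall i, A (row i B).
Proof.
pose S (r : 'I_k.+1) := `[< exists B : 'M[R]_(r, k),
  row_free B /\ forall i, A (row i B) >].
rewrite /lin_dim -/S.
have S0 : (0 < #|[pred r | S r]|)%N.
  (* The empty family makes the maximum range over a nonempty set. *)
  apply/card_gt0P; exists ord0; apply/asboolP; move=> /=.
  by exists 0%R; split=> [|[]//]; rewrite /row_free mxrank0.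
have [r Sr ->] := eq_bigmax_cond (@nat_of_ord k.+1) S0.
move: Sr => /asboolP; case: r => r /= _ + rk.
by rewrite {r}rk => -[B []]; rewrite row_free_unit; exists B.
Qed.

(** With [k] independent differences [p_i - q_i] of points of [A], any vector
    is [z = x + \sum_i c_i (p_i - q_i)], an affine combination of [x], the [p_i]
    and the [q_i]. *)
Lemma affine_hull_full (R : realType) (k : nat) (A : set 'rV[R]_k)
    (x : 'rV[R]_k) :
  A x -> affine_dim A = k -> affine_hull A = setT.
Proof.
move=> Ax /lin_dim_full[B uB AB]; apply/seteqP; split=> // z _.
have /choice[f fP] : forall i, exists pq : 'rV[R]_k * 'rV[R]_k,
    [/\ A pq.1, A pq.2 & row i B = pq.1 - pq.2].
  by move=> i; have [[p q] [/= Ap Aq] pqB] := AB i; exists (p, q).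
pose P := \matrix_i (f i).1; pose Q := \matrix_i (f i).2.
have BPQ : B = P - Q.
  by apply/row_matrixP => i; have [_ _ ->] := fP i; rewrite linearB /= !rowK.
(* Points are stacked as the rows of a block matrix [V], so that the affine
   combination with weights [1], [c], [- c] is the product [a *m V]. *)
pose c : 'rV_k := (z - x) *m invmx B.
pose a : 'rV_(1 + (k + k)) := row_mx 1%:M (row_mx c (- c)).
pose V := col_mx x (col_mx P Q).
exists (1 + (k + k))%N, (fun i => row i V), (a 0); split.
- move=> i; case: (split_ordP i) => [j|{}i] ->; rewrite ?rowKu ?rowKd.
    by rewrite ord1 row_id.
  by case: (split_ordP i) => j ->; rewrite ?rowKu ?rowKd rowK; case: (fP j).
- rewrite !big_split_ord /= big_ord1 row_mxEl mxE mulr1n -big_split /=.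
  rewrite big1 ?addr0// => i _.
  by rewrite !row_mxEr row_mxEl [in X in _ + X]mxE subrr.
- rewrite -[RHS](mulmx_sum_row a V) /a /V !mul_row_col mul1mx mulNmx.
  by rewrite -mulmxBr -BPQ mulmxKV // addrCA subrr addr0.
Qed.

Lemma relint_full_nbhs (R : realType) (k : nat) (A : set 'rV[R]_k)
    (x : 'rV[R]_k) :
  relint A x -> affine_dim A = k -> nbhs x (relint A).
Proof.
move=> [Ax [V [oV Vx] VA]] dA; rewrite /relint.
rewrite (affine_hull_full Ax dA) setIT in VA *.
have : nbhs x V by exact: open_nbhs_nbhs.
apply: filterS => z Vz; split; first exact: VA.
by exists V; rewrite ?setIT.
Qed.

(** Jacobians act on row vectors from the right, so the chain rule for
    [F \o G = id] reads ['J G x *m 'J F (G x) = 1]. *)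
Lemma jacobian_rank_right_inverse (R : realType) (k d : nat)
    (G : 'rV[R]_k -> 'rV[R]_d) (F : 'rV[R]_d -> 'rV[R]_k) (x : 'rV[R]_k) :
  differentiable G x -> differentiable F (G x) ->
  (\forall b \near x, F (G b) = b) -> \rank ('J F (G x)) = k.
Proof.
move=> dG dF FG.
have JJ : 'J G x *m 'J F (G x) = 1%:M.
  apply/row_matrixP => i; rewrite !rowE mulmxA mulmx1.
  rewrite -!deriveEjacobian //.
  rewrite (deriveE _ dG) (deriveE _ dF).
  rewrite -[LHS]/(('d F (G x) \o 'd G x) _) -diff_comp // -deriveE.
    by rewrite -[RHS](derive_id x); exact: near_eq_derive.
  exact: differentiable_comp.
apply/eqP; rewrite eqn_leq rank_leq_col /= -{1}(mxrank1 R k) -JJ.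
exact: mxrankM_maxr.
Qed.

Lemma differentiable_row_mxl (R : realType) (a b : nat)
    (w : 'rV[R]_b) (x : 'rV[R]_a) :
  differentiable (fun v => row_mx v w) x.
Proof.
pose f : {linear 'rV[R]_a -> 'rV[R]_(a + b)} :=
  mulmxr (row_mx 1%:M 0 : 'M[R]_(a, a + b)).
have -> : (fun v : 'rV_a => row_mx v w) = (f : 'rV_a -> _) + cst (row_mx 0 w).
  apply/funext => v; rewrite /f fctE /= mul_mx_row mulmx1 mulmx0.
  by rewrite add_row_mx addr0 add0r.
apply: differentiableD => //; apply: linear_differentiable.
move=> u A /nbhs_ballP[e /= e0 eA].
apply/nbhs_ballP; exists e => //= v [_ uv]; apply: eA; split => // i j.
rewrite /f /= !mul_mx_row !mulmx1 !mulmx0.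
case: (split_ordP j) => l ->; rewrite ?row_mxEl ?row_mxEr; first exact: uv.
by rewrite !mxE; exact: ballxx.
Qed.

Lemma smooth_on_differentiable (R : realType) (a b : nat)
    (X Y : topologicalType)
    (A : set (chart R a X)) (B : set (chart R b Y)) (U : set X) (f : X -> Y)
    (c : chart R a X) (c' : chart R b Y) (x : X) :
  smooth_on A B U f -> A c -> B c' -> cdom c x -> U x -> cdom c' (f x) ->
  differentiable (cmap c' \o f \o cinv c) (cmap c x).
Proof.
move=> [_ sf] Ac Bc' cx Ux c'fx; have [+ _] := sf c c' Ac Bc' 1%N.
by apply; exists x.
Qed.

Lemma pair_cst_continuous (S T : topologicalType) (w : T) :
  continuous (fun b : S => (b, w)).
Proof. by move=> x; apply: cvg_pair => /=; [exact: cvg_id|exact: cvg_cst]. Qed.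

(** The partial map [g (_, w)] is a local section of [mu]; it is taken as a
    slice of a map on the product because smoothness of a trivialization is
    given in product charts. *)
Lemma smooth_section_rank (R : realType) (d e k : nat)
    (M N : topologicalType) (A : set (chart R d M)) (B : set (chart R e N))
    (mu : M -> 'rV[R]_k) (U : set ('rV[R]_k * N)) (g : 'rV[R]_k * N -> M)
    (x : 'rV[R]_k) (w : N) :
  smooth_manifold A -> smooth_manifold B ->
  smooth_on A (@euclid R k) setT mu ->
  open U -> U (x, w) -> smooth_on (prod_atlas (@euclid R k) B) A U g ->
  (\forall b \near x, mu (g (b, w)) = b) ->
  rank_at A mu (g (x, w)) k.
Proof.
move=> [_ _ chA _ _] [_ _ chB covB _] smu oU Ux sg sec c Ac cx.
have [c' Bc' c'w] := covB w.
have [cO _ _ _ cK] := chA _ Ac.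
have [_ _ _ _ c'K] := chB _ Bc'.
pose C := prod_chart (Chart setT id id : chart R k 'rV[R]_k) c'.
have AC : prod_atlas (@euclid R k) B C by exists (Chart setT id id, c').
pose F := mu \o cinv c.
pose G b := cmap c (g (b, w)).
have GE : G = (cmap c \o g \o cinv C) \o (fun b => row_mx b (cmap c' w)).
  by apply/funext => b; rewrite /G /= row_mxKl row_mxKr c'K.
have dF : differentiable F (G x).
  exact: (smooth_on_differentiable smu Ac (c' := Chart setT id id)).
have dG : differentiable G x.
  rewrite GE; apply: differentiable_comp; first exact: differentiable_row_mxl.
  exact: (@smooth_on_differentiable _ _ _ _ _ _ _ _ _ C c (x, w) sg).
apply: (jacobian_rank_right_inverse dG dF).
(* [cinv c] inverts [cmap c] only on the domain of [c], which the section
   does not leave near [x]. *)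
have cg : {for x, continuous (fun b => g (b, w))}.
  have gc : {for (x, w), continuous g}.
    have [+ _] := sg; rewrite continuous_open_subspace //.
    by apply; rewrite inE.
  exact: (@continuous_comp _ _ _ (fun b => (b, w)) g x
    (@pair_cst_continuous _ _ w x) gc).
have gdom : \forall b \near x, cdom c (g (b, w)).
  by apply: cg; apply: open_nbhs_nbhs.
near=> b; rewrite /F /G /= cK; last by near: b.
by near: b.
Unshelve. all: by end_near.
Qed.

(** Fixing the fiber coordinate of [y] in a local trivialization gives a
    smooth section of [mu] through [y]; it is a section over an open set of
    R^k because [D] is a neighborhood of [mu y]. *)
Lemma smooth_bundle_rank (R : realType) (d k : nat)
    (M : topologicalType) (A : set (chart R d M))
    (mu : M -> 'rV[R]_k) (S : set M) (D : set 'rV[R]_k) (y : M) :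
  smooth_manifold A -> smooth_on A (@euclid R k) setT mu ->
  smooth_bundle A S D mu -> S y -> nbhs (mu y) D -> rank_at A mu y k.
Proof.
move=> mA smu [SD [N [e [B [mB triv]]]]] Sy nD.
have Dy := nbhs_singleton nD.
have [V [phi [oV Vy [g [_ sg gK Kg]]]]] := triv _ Dy.
have [DVT gy] := gK y (conj Sy Vy).
(* The inverse trivialization [g] is smooth only as the restriction of an
   ambient smooth map [g'], which agrees with [g] over [D `&` V]. *)
have [U [g' [oU Uy sg' g'g]]] := sg _ DVT.
have g'y : g' (mu y, phi y) = y by rewrite g'g.
rewrite -g'y; apply: (smooth_section_rank mA mB smu oU Uy sg').
have Unear : \forall b \near mu y, U (b, phi y).
  by apply: (@pair_cst_continuous _ _ (phi y) (mu y) U); apply: open_nbhs_nbhs.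
have Vnear : \forall b \near mu y, V b by apply: open_nbhs_nbhs.
near=> b.
have bDV : ((D `&` V) `*` [set: N]) (b, phi y).
  by split=> //; split; near: b.
have [_ [mugb _]] := Kg _ bDV.
by rewrite g'g //; near: b.
Unshelve. all: by end_near.
Qed.

Lemma stratum_stratum_index (R : realType) (d m : nat) (M : topologicalType)
    (ch : 'I_m -> chart R d M) (y : M) :
  stratum ch (stratum_index ch y) y.
Proof. by split=> i /=; rewrite inE => /asboolP. Qed.

Theorem theorem7p6 (R : realType) (n k : nat) (X : nk_manifold R n k)
    (x : 'rV[R]_k) (hx : nk_polytope X x) (hreg : regular_point X x) :
  regular_value X x.
Proof.
move=> y yx; have Wy := stratum_stratum_index (@nk_ch R n k X) y.
set s := stratum_index _ y in Wy.
have adm : admissible (@nk_ch R n k X) s by exists y.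
have [muW _ _ _] := nk_axiom4 adm.
have Dx : relint (adm_polytope (@nk_mu R n k X) (@nk_fp R n k X) s) x.
  by rewrite -muW; exists y.
have [leaves _ _ _ _] := nk_axiom5 adm.
have [_ bundle] := leaves (xi (@nk_h R n k X) s (orb _ y)).
apply: (smooth_bundle_rank (nk_smooth X) (nk_mu_smooth X) bundle) => //.
by rewrite yx; apply: relint_full_nbhs => //; exact: hreg.
Qed.
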